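(* Let $\mathfrak M$ be a Steiner triple system. If $\mathfrak M$ does not contain any Veblen subconfiguration (is anti-Pasch, or Pasch-free), then $\circledast^{3}\mathfrak M$ is also anti-Pasch, and its unique linear completion $\widetilde{\circledast^{3}\mathfrak M}$ is anti-Pasch as well. However, $\widetilde{\circledast^{3}\mathfrak M}$ contains a miter-configuration for each $\mathfrak M$.
   Context: A partial Steiner triple system (PSTS) is a structure $\mathfrak M=\langle S,\mathcal L\rangle$ with point set $S$ and a family $\mathcal L$ of 3-element subsets of $S$ (lines) such that any two distinct points lie on at most one line; it is a Steiner triple system (STS) if any two distinct points lie on exactly one line. $C_3$ is the group of integers modulo 3. $\circledast^{3}\mathfrak M$ (the configuration 3-weaved from $\mathfrak M$) is the PSTS with point set $S\times C_3$ whose lines are all the sets $\{(a,i),(b,i),(c,i+1)\}$ with $\{a,b,c\}\in\mathcal L$ (in any ordering of $a,b,c$) and $i\in C_3$. A linear completion of a PSTS is a linear space with the same point set, extending the PSTS, all of whose lines have the size of the lines of the PSTS (that is, 3). When $\mathfrak M$ is an STS, $\circledast^{3}\mathfrak M$ has a unique linear completion $\widetilde{\circledast^{3}\mathfrak M}$; its lines are the lines of $\circledast^{3}\mathfrak M$ together with all the sets $\{a\}\times C_3$, $a\in S$. A Veblen (= Pasch) configuration consists of 6 points and 4 lines of size 3, any two of the lines meeting in a point and each point lying on exactly two of them; anti-Pasch (Pasch-free) means containing no such configuration. Put $p\circledcirc p=p$, and $p\circledcirc q=r$ when $\{p,q,r\}$ is a line. A triangle $\{a,b,c\}$ (three pairwise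 collinear points not on a line) determines a miter configuration with center $a$ when $a\circledcirc(b\circledcirc c)=(a\circledcirc b)\circledcirc(a\circledcirc c)$; the configuration consists of the points $a,\ b,\ c,\ a\circledcirc b,\ a\circledcirc c,\ b\circledcirc c,\ a\circledcirc(b\circledcirc c)$. *)

(* Defs.v *)
From mathcomp Require Import all_boot all_order all_algebra.
From mathcomp Require Import all_classical.

Set Implicit Arguments.
Unset Strict Implicit.
Unset Printing Implicit Defensive.

Local Open Scope classical_set_scope.
Local Open Scope card_scope.
Local Open Scope ring_scope.

(* An incidence structure on a point type S (finite or not) is given by its
   family of lines, L : set (set S). *)

Definition three_element (S : Type) (l : set S) : Prop := l #= `I_3.

Definition steiner_triple_system (S : Type) (L : set (set S)) : Prop :=
  (forall l, L l -> three_element l) /\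
  (forall p q, p <> q -> exists! l, [/\ L l, l p & l q]).

Definition linear_space (S : Type) (N : set (set S)) : Prop :=
  (forall l, N l -> exists p q, [/\ p <> q, l p & l q]) /\
  (forall p q, p <> q -> exists! l, [/\ N l, l p & l q]).

Definition linear_completion (S : Type) (L N : set (set S)) : Prop :=
  [/\ linear_space N, L `<=` N & forall l, N l -> three_element l].

(* For a family of 3-element sets, L [set a; b; c] forces a, b, c to be
   pairwise distinct; quantifying over a, b and c accounts for every ordering
   of the line. *)
Definition weave3 (S : Type) (L : set (set S)) : set (set (S * 'Z_3)) :=
  [set l | exists a b c (i : 'Z_3),
     L [set a; b; c] /\ l = [set (a, i); (b, i); (c, i + 1)]].

Definition veblen_configuration (S : Type) (P : set S) (Q : set (set S)) :
    Prop :=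
  [/\ P #= `I_6,
      Q #= `I_4,
      forall l, Q l -> l `<=` P /\ three_element l,
      forall l m, Q l -> Q m -> l <> m -> l `&` m !=set0
    & forall p, P p -> [set l | Q l /\ l p] #= `I_2].

Definition anti_pasch (S : Type) (L : set (set S)) : Prop :=
  ~ exists P Q, veblen_configuration P Q /\ Q `<=` L.

(* Graph of the partial operation: circ L p q r means that the product of p
   and q is defined and equals r. *)
Definition circ (S : Type) (L : set (set S)) (p q r : S) : Prop :=
  (p = q /\ r = p) \/ (p <> q /\ L [set p; q; r]).

Definition collinear (S : Type) (L : set (set S)) (p q : S) : Prop :=
  exists l, [/\ L l, l p & l q].

Definition triangle (S : Type) (L : set (set S)) (a b c : S) : Prop :=
  [/\ [/\ a <> b, a <> c & b <> c],
      [/\ collinear L a b, collinear L a c & collinear L b c]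
    & ~ exists l, [/\ L l, l a, l b & l c]].

(* The common value d witnesses that both sides of
   a o (b o c) = (a o b) o (a o c) are defined and equal. *)
Definition miter_with_center (S : Type) (L : set (set S)) (a b c : S) : Prop :=
  triangle L a b c /\
  exists ab ac bc d,
    [/\ circ L a b ab, circ L a c ac & circ L b c bc] /\
    (circ L a bc d /\ circ L ab ac d).

Definition contains_miter (S : Type) (L : set (set S)) : Prop :=
  exists a b c, miter_with_center L a b c.

(* Main.v *)
Require Import Defs.
From mathcomp Require Import all_boot all_order all_algebra.
From mathcomp Require Import all_classical.
From mathcomp Require Import ring.

Set Implicit Arguments.
Unset Strict Implicit.
Unset Printing Implicit Defensive.

Local Open Scope classical_set_scope.
Local Open Scope card_scope.
Local Open Scope ring_scope.

Import GRing.Theory.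

(** Three points (a, i), (b, j), (c, k) with {a, b, c} a line form a line of the
    weaving exactly when i + j + k = 1 modulo 3. Adding this equation over the
    two lines through a point of a Pasch configuration without a vertical line
    shows that opposite points lie on the same level; they thus project to
    distinct points, and the configuration projects to a Pasch configuration.
    A vertical line would force two points of another line to have the same
    projection. The lifts of one line and the three verticals above its points
    form an affine plane of order 3, which contains a miter. *)

(** * Sets with few elements *)

Section SmallSets.
Variable T : Type.
Implicit Types (A B : set T).

Lemma card_II_setU1 B (x : T) n :
  ~ B x -> B #= `I_n -> B `|` [set x] #= `I_n.+1.
Proof.
move=> nBx Bn; apply/eq_cardSP; exists x; first by right.
rewrite setDUl setDv setU0 not_setD1//.
Qed.

Lemma card_IIS A n : A #= `I_n.+1 ->
  exists B x, [/\ A = B `|` [set x], ~ B x & B #= `I_n].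
Proof.
move=> /eq_cardSP[x Ax An]; exists (A `\ x), x.
split=> //; last by move=> [_]; apply.
apply/seteqP; split=> y => [Ay|[[]//|->//]].
by have [->|yx] := pselect (y = x); [right | left].
Qed.

Lemma card_II1_ex A : A #= `I_1 -> exists a, A = [set a].
Proof.
move=> /card_IIS[B [a [-> _]]]; rewrite II0 card_eq0 => /eqP ->.
by exists a; rewrite set0U.
Qed.

Lemma card_II2_ex A : A #= `I_2 -> exists a b, A = [set a; b] /\ a <> b.
Proof.
move=> /card_IIS[B [b [-> Bb /card_II1_ex[a Ba]]]]; subst B.
by exists a, b; split=> // ab; apply: Bb.
Qed.

Lemma three_element_ex A : three_element A ->
  exists a b c, A = [set a; b; c] /\ [/\ a <> b, a <> c & b <> c].
Proof.
move=> /card_IIS[B [c [-> Bc /card_II2_ex[a [b [Bab ab]]]]]]; subst B.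
by exists a, b, c; split=> //; split=> // e; apply: Bc; [left|right].
Qed.

Lemma card_II2P (a b : T) : a <> b -> [set a; b] #= `I_2.
Proof. by move=> ab; apply: card_II_setU1 card_set1 => /esym. Qed.

(** Trades the cardinality of a line for disequalities: a coincidence among [a], [b], [c] would
    leave too few values for three distinct elements. *)
Lemma three_elementP (a b c : T) :
  three_element [set a; b; c] <-> [/\ a <> b, a <> c & b <> c].
Proof.
split; last first.
  by case=> ab ac bc; apply: card_II_setU1 (card_II2P ab) => -[] /esym.
move=> /three_element_ex[x [y [z [E [xy xz yz]]]]].
have Hx : [set a; b; c] x by rewrite E; left; left.
have Hy : [set a; b; c] y by rewrite E; left; right.
have Hz : [set a; b; c] z by rewrite E; right.
split=> e; move: Hx Hy Hz; rewrite e; move=> [[]|] /= + [[]|] /= + [[]|] /=;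
  congruence.
Qed.

Lemma three_element_with A (a b : T) : three_element A -> A a -> A b ->
  a <> b -> exists c, [/\ A = [set a; b; c], a <> c & b <> c].
Proof.
move=> /three_element_ex[x [y [z [-> [xy xz yz]]]]].
by move=> [[]|] /= -> [[]|] /= -> // _; [exists z|exists y|exists z|exists x
  |exists y|exists x]; split=> //; (try by move=> /esym);
  apply/seteqP; split=> w /=; tauto.
Qed.

Lemma three_element_eq A (a b c : T) : three_element A -> A a -> A b -> A c ->
  a <> b -> a <> c -> b <> c -> A = [set a; b; c].
Proof.
move=> A3 Aa Ab Ac ab ac bc.
have [d [AE _ _]] := three_element_with A3 Aa Ab ab.
by move: Ac; rewrite {}AE => -[[/= /esym//|/= /esym//]|/= ->].
Qed.

Lemma set3C12 (a b c : T) : [set a; b; c] = [set b; a; c].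
Proof. by rewrite (setUC [set a]). Qed.

Lemma set3C23 (a b c : T) : [set a; b; c] = [set a; c; b].
Proof. by rewrite setUAC. Qed.

(** The two adjacent transpositions generate all orderings of a triple. *)
Lemma set3_perm_ind (P : T -> T -> T -> Prop) (a b c p q r : T) :
  (forall x y z, P x y z -> P y x z) -> (forall x y z, P x y z -> P x z y) ->
  [/\ p <> q, p <> r & q <> r] -> [set p; q; r] = [set a; b; c] ->
  P a b c -> P p q r.
Proof.
move=> P12 P23 [pq pr qr] E Pabc.
have Hp : [set a; b; c] p by rewrite -E; left; left.
have Hq : [set a; b; c] q by rewrite -E; left; right.
have Hr : [set a; b; c] r by rewrite -E; right.
by case: Hp => [[]|] /= ?; case: Hq => [[]|] /= ?; case: Hr => [[]|] /= ?;
  subst => //; auto.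
Qed.

End SmallSets.

(** * Veblen configurations as labelled sextuples of points *)

(* Primes pair up the opposite points, those not joined by one of the lines. *)
Definition pasch (T : Type) (L : set (set T)) (x x' y y' z z' : T) : Prop :=
  [/\ x <> x', y <> y' & z <> z'] /\
  [/\ L [set x; y; z], L [set x; y'; z'], L [set x'; y; z'] & L [set x'; y'; z]].

(** The six labelled points are the pairwise intersections of the four lines. They fill the lines
    because no point lies on three of them. *)
Lemma veblen_pasch (T : Type) (L : set (set T)) P Q :
  veblen_configuration P Q -> Q `<=` L ->
  exists x x' y y' z z' : T, pasch L x x' y y' z z'.
Proof.
move=> [_ /card_IIS[Q' [l4 [QE Q'4 /three_element_ex[l1 [l2 [l3 [Q'E ds]]]]]]]].
subst Q'; case: ds => l12 l13 l23 Qsub meet deg QL.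
have Q1 : Q l1 by rewrite QE; do 3 left.
have Q2 : Q l2 by rewrite QE; do 2 left; right.
have Q3 : Q l3 by rewrite QE; left; right.
have Q4 : Q l4 by rewrite QE; right.
have l14 : l1 <> l4 by move=> e; apply: Q'4; rewrite -e; do 2 left.
have l24 : l2 <> l4 by move=> e; apply: Q'4; rewrite -e; left; right.
have l34 : l3 <> l4 by move=> e; apply: Q'4; rewrite -e; right.
have not3 l m n p : Q l -> Q m -> Q n -> l <> m -> l <> n -> m <> n ->
    l p -> m p -> n p -> False.
  move=> Ql Qm Qn lm ln mn lp mp np.
  have Pp : P p by apply: (Qsub _ Ql).1.
  have [u [v [uvE _]]] := card_II2_ex (deg _ Pp).
  have Hl : [set u; v] l by rewrite -uvE.
  have Hm : [set u; v] m by rewrite -uvE.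
  have Hn : [set u; v] n by rewrite -uvE.
  by move: Hl Hm Hn => [] /= ? [] /= ? [] /= ?; congruence.
(* Opposite points come from complementary pairs of lines; the unprimed points are those on [l1]. *)
have [x [x1 x2]] := meet _ _ Q1 Q2 l12.
have [x' [x'3 x'4]] := meet _ _ Q3 Q4 l34.
have [y [y1 y3]] := meet _ _ Q1 Q3 l13.
have [y' [y'2 y'4]] := meet _ _ Q2 Q4 l24.
have [z [z1 z4]] := meet _ _ Q1 Q4 l14.
have [z' [z'2 z'3]] := meet _ _ Q2 Q3 l23.
have neq l m n p q : Q l -> Q m -> Q n -> l <> m -> l <> n -> m <> n ->
    l p -> m p -> n q -> p <> q.
  by move=> Ql Qm Qn lm ln mn lp mp nq pq; apply: (not3 l m n p) => //;
    rewrite pq.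
have l21 := nesym l12; have l31 := nesym l13; have l41 := nesym l14.
have l32 := nesym l23; have l42 := nesym l24; have l43 := nesym l34.
exists x, x', y, y', z, z'; split.
  by split; [apply: (neq l1 l2 l3)|apply: (neq l1 l3 l2)|apply: (neq l1 l4 l2)].
split.
- rewrite -(@three_element_eq _ l1)//; [exact: QL|exact: (Qsub _ Q1).2|..].
  + exact: (neq l1 l2 l3).
  + exact: (neq l1 l2 l4).
  + exact: (neq l1 l3 l4).
- rewrite -(@three_element_eq _ l2)//; [exact: QL|exact: (Qsub _ Q2).2|..].
  + exact: (neq l1 l2 l4).
  + exact: (neq l1 l2 l3).
  + exact: (neq l2 l4 l3).
- rewrite -(@three_element_eq _ l3)//; [exact: QL|exact: (Qsub _ Q3).2|..].
  + exact: (neq l3 l4 l1).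
  + exact: (neq l3 l4 l2).
  + exact: (neq l1 l3 l2).
- rewrite -(@three_element_eq _ l4)//; [exact: QL|exact: (Qsub _ Q4).2|..].
  + exact: (neq l3 l4 l2).
  + exact: (neq l3 l4 l1).
  + exact: (neq l2 l4 l1).
Qed.

(** Two points that are not opposite share one of the lines, whose size makes them distinct; all six
    points therefore differ. *)
Lemma pasch_veblen (T : Type) (L : set (set T)) (x x' y y' z z' : T) :
  (forall l, L l -> three_element l) -> pasch L x x' y y' z z' ->
  exists P Q, veblen_configuration P Q /\ Q `<=` L.
Proof.
move=> L3 [[xx yy zz] [L1 L2 L3' L4]].
have /three_elementP[xy xz yz] := L3 _ L1.
have /three_elementP[xy' xz' yz'] := L3 _ L2.
have /three_elementP[x'y x'z' yz''] := L3 _ L3'.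
have /three_elementP[x'y' x'z y'z] := L3 _ L4.
set l1 := [set x; y; z] in L1; set l2 := [set x; y'; z'] in L2.
set l3 := [set x'; y; z'] in L3'; set l4 := [set x'; y'; z] in L4.
have D (l m : set T) p : l p -> ~ m p -> l <> m.
  by move=> lp nmp e; rewrite -e in nmp.
have l12 : l1 <> l2.
  by apply: (D _ _ y); [left; right|move=> [[]|] /=; auto].
have l13 : l1 <> l3.
  by apply: (D _ _ x); [left; left|move=> [[]|] /=; auto].
have l14 : l1 <> l4.
  by apply: (D _ _ x); [left; left|move=> [[]|] /=; auto].
have l23 : l2 <> l3.
  by apply: (D _ _ x); [left; left|move=> [[]|] /=; auto].
have l24 : l2 <> l4.
  by apply: (D _ _ x); [left; left|move=> [[]|] /=; auto].
have l34 : l3 <> l4.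
  by apply: (D _ _ y); [left; right|move=> [[]|] /=; auto].
exists [set x; x'; y; y'; z; z'], [set l1; l2; l3; l4]; split; last first.
  by move=> l [[[]|]|] /= ->.
split.
- apply: card_II_setU1; last apply: card_II_setU1; last apply: card_II_setU1;
    last apply/three_elementP; last by split=> // /esym.
  + by move=> [[[[]|]|]|] /= /esym; auto.
  + by move=> [[[]|]|] /= /esym; auto.
  + by move=> [[]|] /= /esym; auto.
- apply: card_II_setU1; last by apply/three_elementP; split.
  by move=> [[]|] /= /esym; auto.
- move=> l Ql; split; last by apply: L3; move: Ql => [[[]|]|] /= ->.
  by move: Ql => [[[]|]|] /= -> p [[]|] /=; rewrite /setU /=; tauto.
- have c12 : l1 `&` l2 !=set0 by exists x; split; left; left.
  have c13 : l1 `&` l3 !=set0 by exists y; split; left; right.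
  have c14 : l1 `&` l4 !=set0 by exists z; split; right.
  have c23 : l2 `&` l3 !=set0 by exists z'; split; right.
  have c24 : l2 `&` l4 !=set0 by exists y'; split; left; right.
  have c34 : l3 `&` l4 !=set0 by exists x'; split; left; left.
  by move=> l m [[[]|]|] /= -> [[[]|]|] /= -> // _; rewrite // setIC.
move=> p Pp.
(* For each [p], the four lines are reordered so that the two through [p] come first. *)
have pairE (l m l' m' : set T) : [set l1; l2; l3; l4] = [set l; m; l'; m'] ->
  l p -> m p -> ~ l' p -> ~ m' p -> l <> m ->
  [set k | [set l1; l2; l3; l4] k /\ k p] #= `I_2.
  move=> E lp mp nl' nm' lm.
  suff -> : [set k | [set l1; l2; l3; l4] k /\ k p] = [set l; m].
    exact: card_II2P.
  rewrite E; apply/seteqP; split=> k /=.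
    by move=> [[[[]|]|] -> //]; [left|right].
  by move=> [] ->; split=> //; do 2 left; [left|right].
have in3 a (u v w : T) : a = u \/ a = v \/ a = w -> [set u; v; w] a.
  by rewrite /setU /=; tauto.
have notin3 a (u v w : T) : a <> u -> a <> v -> a <> w -> ~ [set u; v; w] a.
  by rewrite /setU /=; tauto.
case: Pp => [[[[[]|]|]|]|] /= pE; subst p;
  [apply: (pairE l1 l2 l3 l4)|apply: (pairE l3 l4 l1 l2)
  |apply: (pairE l1 l3 l2 l4)|apply: (pairE l2 l4 l1 l3)
  |apply: (pairE l1 l4 l2 l3)|apply: (pairE l2 l3 l1 l4)] => //;
  try (by apply/seteqP; split=> k; rewrite /setU /=; tauto);
  try (by apply: in3; tauto);
  by apply: notin3; congruence.
Qed.

(** * Steiner triples and coordinates for the lines of the weaving *)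

Section Weave.
Variables (S : Type) (L : set (set S)).
Hypothesis sts_L : steiner_triple_system L.
Implicit Types (p q r : S * 'Z_3) (l : set (S * 'Z_3)).

Lemma sts_neq (a b c : S) : L [set a; b; c] -> [/\ a <> b, a <> c & b <> c].
Proof. by move=> /sts_L.1/three_elementP. Qed.

Lemma sts_third_unique (a b c d : S) :
  L [set a; b; c] -> L [set a; b; d] -> c = d.
Proof.
move=> Lc Ld; have [ab ac bc] := sts_neq Lc.
have [m [_ mU]] := sts_L.2 _ _ ab.
have cE : m = [set a; b; c] by apply: mU; split=> //; left; [left|right].
have dE : m = [set a; b; d] by apply: mU; split=> //; left; [left|right].
have : [set a; b; d] c by rewrite -dE cE; right.
by move=> [[]|] /= => [/esym//|/esym//|].
Qed.

Lemma sts_third (a b : S) : a <> b -> exists c, L [set a; b; c].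
Proof.
move=> ab; have [m [[Lm ma mb] _]] := sts_L.2 _ _ ab.
have [c [mE _ _]] := three_element_with (sts_L.1 _ Lm) ma mb ab.
by exists c; rewrite -mE.
Qed.

Lemma weave3_three_element l : weave3 L l -> three_element l.
Proof.
move=> [a [b [c [i [/sts_neq[ab ac bc] ->]]]]].
by apply/three_elementP; split=> -[].
Qed.

(* Levels that are all equal or pairwise distinct have sum 0 modulo 3, so sum 1
   singles out the triples i, i, i + 1 (up to order). *)
Lemma weave3E p q r : weave3 L [set p; q; r] <->
  L [set p.1; q.1; r.1] /\ p.2 + q.2 + r.2 = 1.
Proof.
split=> [W|].
  have /three_elementP dpqr := weave3_three_element W.
  have [a [b [c [i [Labc E]]]]] := W.
  apply: (set3_perm_ind (P := fun p q r => L [set p.1; q.1; r.1] /\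
    p.2 + q.2 + r.2 = 1) _ _ dpqr E).
  - by move=> x y z [Lxyz <-]; rewrite set3C12; split=> //; ring.
  - by move=> x y z [Lxyz <-]; rewrite set3C23; split=> //; ring.
  - by split=> //=; case: i {W E} => [[|[|[|]]]//] ?; apply/val_inj.
case: p q r => [a i] [b j] [c k] /= [Labc].
move=> ijk; have -> : k = 1 - i - j by rewrite -ijk; ring.
(* The cases decide which point is the one a level above the other two: the third, the second, or
   the first. *)
have [->|ij] := eqVneq i j.
  exists a, b, c, j; split=> //; congr (_ `|` [set (c, _)]).
  by case: j {ijk} => [[|[|[|]]]//] ?; apply/val_inj.
have [->|ij1] := eqVneq j (i + 1).
  exists a, c, b, i; split; first by rewrite set3C23.
  rewrite set3C23; congr (_ `|` [set (c, _)] `|` _).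
  by case: i {ijk ij} => [[|[|[|]]]//] ?; apply/val_inj.
exists b, c, a, j; split; first by rewrite -set3C23 -set3C12.
rewrite set3C12 set3C23.
have -> : i = j + 1.
  by case: i j {ijk} ij ij1 => [[|[|[|]]]//] ? [[|[|[|]]]//] ? *;
    apply/val_inj.
congr (_ `|` [set (c, _)] `|` _).
by case: j {ij ij1 ijk} => [[|[|[|]]]//] ?; apply/val_inj.
Qed.

(** * Vertical lines and the unique linear completion *)

Definition fiber (a : S) : set (S * 'Z_3) := [set (a, 0); (a, 1); (a, 2%:R)].

Lemma fiberE (a : S) p : fiber a p <-> p.1 = a.
Proof.
split=> [[[]|] -> //|]; case: p => b [[|[|[|]]]//] ? /= ->;
  [left; left|left; right|right]; congr (_, _); exact/val_inj.
Qed.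

Definition weave3_completion : set (set (S * 'Z_3)) :=
  weave3 L `|` range fiber.

Lemma completion_three_element l : weave3_completion l -> three_element l.
Proof.
by move=> [/weave3_three_element//|[a _ <-]]; apply/three_elementP; split.
Qed.

Lemma weave3_not_vertical l p q : weave3 L l -> l p -> l q -> p <> q ->
  p.1 <> q.1.
Proof.
move=> Wl lp lq pq.
have [r [lE _ _]] := three_element_with (weave3_three_element Wl) lp lq pq.
by move: Wl; rewrite lE => /weave3E[/sts_neq[]].
Qed.

Lemma weave3_line p q : p.1 <> q.1 -> exists l, [/\ weave3 L l, l p & l q].
Proof.
move=> pq; have [c Lc] := sts_third pq.
(* The third level is chosen to make the sum of levels 1. *)
exists [set p; q; (c, 1 - p.2 - q.2)]; split; last 2 first.
- by left; left.
- by left; right.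
by apply/weave3E; split=> //=; ring.
Qed.

(** Two points fix the third: its projection by the Steiner property, its level by the sum. *)
Lemma weave3_line_unique l m p q : p <> q -> weave3 L l -> weave3 L m ->
  l p -> l q -> m p -> m q -> l = m.
Proof.
move=> pq Wl Wm lp lq mp mq.
have [r [lE _ _]] := three_element_with (weave3_three_element Wl) lp lq pq.
have [s [mE _ _]] := three_element_with (weave3_three_element Wm) mp mq pq.
move: Wl Wm; rewrite lE mE => /weave3E[Lr r1] /weave3E[Ls].
rewrite -{}r1 => /addrI rs.
congr (_ `|` [set _]).
by case: r s {lE mE} Lr Ls rs => ? ? [? ?] /= /sts_third_unique /[apply] -> ->.
Qed.

Lemma completion_linear_space : linear_space weave3_completion.
Proof.
split=> [l /completion_three_element/three_element_ex|p q pq].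
  move=> [a [b [c [-> [ab _ _]]]]].
  by exists a, b; split=> //; left; [left|right].
have [pq1|pq1] := pselect (p.1 = q.1).
  exists (fiber p.1); split.
    by split; [right; exists p.1|exact/fiberE|exact/fiberE].
  move=> l [[Wl lp lq|[a _ <-] /fiberE -> //]].
  by have := weave3_not_vertical Wl lp lq pq.
have [l [Wl lp lq]] := weave3_line pq1.
exists l; split=> [|m [[Wm|[a _ <-]] mp mq]]; first by split=> //; left.
  exact: (weave3_line_unique pq).
by move: mp mq pq1 => /fiberE -> /fiberE ->.
Qed.

Lemma completion_linear_completion :
  linear_completion (weave3 L) weave3_completion.
Proof.
split; [exact: completion_linear_space|by move=> l Wl; left|].
exact: completion_three_element.
Qed.

Lemma linear_completion_line N l m p q : linear_completion (weave3 L) N ->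
  p <> q -> N l -> N m -> l p -> l q -> m p -> m q -> l = m.
Proof.
move=> [[_ NU] _ _] pq Nl Nm lp lq mp mq; have [k [_ kU]] := NU _ _ pq.
by rewrite -(kU l)// (kU m).
Qed.

(** If [l] left the fiber at some [r], it would be the weaving line through [p] and [r], which
    cannot contain two points of one fiber. So [l] lies in the fiber, and both have three points. *)
Lemma linear_completion_vertical N l p q : linear_completion (weave3 L) N ->
  N l -> l p -> l q -> p <> q -> p.1 = q.1 -> l = fiber p.1.
Proof.
move=> NC Nl lp lq pq pq1; have [_ WN N3] := NC.
have vert r : l r -> r.1 = p.1.
  move=> lr; apply: contrapT => /nesym pr1.
  have [m [Wm mp mr]] := weave3_line pr1.
  have pr : p <> r by move=> e; rewrite e in pr1.
  have lm := linear_completion_line NC pr Nl (WN _ Wm) lp lr mp mr.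
  by rewrite -lm in Wm; have := weave3_not_vertical Wm lp lq pq.
have [r [lE pr qr]] := three_element_with (N3 _ Nl) lp lq pq.
have lr : l r by rewrite lE; right.
rewrite lE; apply/esym/three_element_eq => //; try (by apply/fiberE; auto).
by apply: completion_three_element; right; exists p.1.
Qed.

(** Two points on a line of [N] determine it: it is a fiber if they have the same projection, and
    otherwise the weaving line joining them. *)
Lemma linear_completion_unique N : linear_completion (weave3 L) N ->
  weave3_completion = N.
Proof.
move=> NC; have [[N2 NU] WN N3] := NC; apply/seteqP; split=> l.
  move=> [/WN//|[a _ <-]].
  have a01 : (a, 0) <> (a, 1) :> S * 'Z_3 by [].
  have [m [[Nm m0 m1] _]] := NU _ _ a01.
  by rewrite -(linear_completion_vertical NC Nm m0 m1 a01).
move=> Nl; have [p [q [pq lp lq]]] := N2 _ Nl.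
have [pq1|pq1] := pselect (p.1 = q.1).
  by right; exists p.1; rewrite // -(linear_completion_vertical NC Nl lp lq pq).
have [m [Wm mp mq]] := weave3_line pq1; left.
by rewrite (linear_completion_line NC pq Nl (WN _ Wm)).
Qed.

Lemma completionP p q r : weave3_completion [set p; q; r] ->
  (L [set p.1; q.1; r.1] /\ p.2 + q.2 + r.2 = 1) \/
  (p.1 = q.1 /\ q.1 = r.1).
Proof.
move=> [/weave3E|[a _ E]]; [by left|right].
have f s : [set p; q; r] s -> s.1 = a by rewrite -E => /fiberE.
by rewrite (f p) ?(f q) ?(f r)//; [right|left; right|left; left].
Qed.

(** * Projecting Pasch configurations to the Steiner triple system *)

(** If [x], [y], [z] fill a fiber, the lines through [z'] are not vertical, so [x'] and [y'] both
    project to the third point on the line through [x.1] and [z'.1]. The line of [x'], [y'], [z] is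
    then vertical, which puts [y'] over [x.1], a contradiction. *)
Lemma pasch_not_vertical (x x' y y' z z' : S * 'Z_3) :
  pasch weave3_completion x x' y y' z z' -> x.1 = y.1 -> y.1 = z.1 -> False.
Proof.
move=> [[_ yy _] [N1 N2 N3 N4]] xy yz.
have /three_elementP[xyd xzd yzd] := completion_three_element N1.
have /three_elementP[xy'd _ _] := completion_three_element N2.
have /three_elementP[_ _ y'zd] := completion_three_element N4.
have [[L2 _]|[xy' _]] := completionP N2; last first.
  have : [set x; y; z] y'.
    rewrite -(@three_element_eq _ (fiber x.1))//;
      try by apply/fiberE; congruence.
    by apply: completion_three_element; right; exists x.1.
  by move=> [[]|] /= => [/esym//|/esym//|].
have [_ xz' y'z'] := sts_neq L2.
have [[L3 _]|[_ yz']] := completionP N3; last by rewrite xy yz' in xz'.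
have x'y' : x'.1 = y'.1.
  apply: (sts_third_unique (a := x.1) (b := z'.1)).
    by rewrite set3C23 set3C12 xy.
  by rewrite set3C23.
have [[/sts_neq[]]//|[_ y'z]] := completionP N4.
by have [] := sts_neq L2; rewrite xy yz y'z.
Qed.

Lemma pasch_completion (x x' y y' z z' : S * 'Z_3) :
  pasch weave3_completion x x' y y' z z' ->
  pasch L x.1 x'.1 y.1 y'.1 z.1 z'.1.
Proof.
move=> P; have [[xx yy zz] [N1 N2 N3 N4]] := P.
(* Swapping two opposite pairs at once is a symmetry; these three relabellings bring each remaining
   line to the front. *)
have P2 : pasch weave3_completion x x' y' y z' z.
  by split; split=> //; exact/nesym.
have P3 : pasch weave3_completion x' x y y' z' z.
  by split; split=> //; exact/nesym.
have P4 : pasch weave3_completion x' x y' y z z'.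
  by split; split=> //; exact/nesym.
have [[L1 s1]|[? ?]] := completionP N1; last by case: (pasch_not_vertical P).
have [[L2 s2]|[? ?]] := completionP N2; last by case: (pasch_not_vertical P2).
have [[L3 s3]|[? ?]] := completionP N3; last by case: (pasch_not_vertical P3).
have [[L4 s4]|[? ?]] := completionP N4; last by case: (pasch_not_vertical P4).
split=> //.
(* Summing the level equations of the two lines through a point determines
   twice its level, so opposite points lie on the same level. *)
have double_inj (i j : 'Z_3) : i + i = j + j -> i = j.
  by case: i j => [[|[|[|]]]//] ? [[|[|[|]]]//] ? // _; apply/val_inj.
have level (i i' j j' k k' : 'Z_3) : i + j + k = 1 -> i + j' + k' = 1 ->
    i' + j + k' = 1 -> i' + j' + k = 1 -> i = i'.
  move=> e1 e2 e3 e4; apply: double_inj.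
  apply: (@addIr _ (j + j' + k + k')).
  transitivity ((i + j + k) + (i + j' + k')); first by ring.
  by rewrite e1 e2 -{1}e3 -e4; ring.
have neq1 (p q : S * 'Z_3) : p <> q -> p.2 = q.2 -> p.1 <> q.1.
  by case: p q => [a i] [b j] /= pq ij ab; apply: pq; rewrite ab ij.
split; apply: neq1 => //.
- exact: level s1 s2 s3 s4.
- by apply: (level _ _ x.2 x'.2 z.2 z'.2); rewrite addrAC -1?(addrC _.2) addrA.
- by apply: (level _ _ x.2 x'.2 y.2 y'.2); rewrite -addrA addrC.
Qed.

Lemma completion_anti_pasch : anti_pasch L -> anti_pasch weave3_completion.
Proof.
move=> apL [P [Q [V QN]]]; apply: apL.
have [x [x' [y [y' [z [z' /pasch_completion]]]]]] := veblen_pasch V QN.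
exact: (pasch_veblen sts_L.1).
Qed.

(** * A miter in the completion *)

(** A line of [L] is required: over a single point the completion is one vertical line and has no
    triangle. *)
Lemma completion_contains_miter :
  L !=set0 -> contains_miter weave3_completion.
Proof.
move=> [l Ll].
have [a [b [c [lE [ab ac bc]]]]] := three_element_ex (sts_L.1 _ Ll).
rewrite lE in Ll.
have W p q r : L [set p.1; q.1; r.1] -> \val (p.2 + q.2 + r.2) = 1%N ->
    weave3_completion [set p; q; r].
  by move=> Lpqr s; left; apply/weave3E; split=> //; apply/val_inj.
have Lacb : L [set a; c; b] by rewrite set3C23.
have N1 : weave3_completion (fiber a) by right; exists a.
have N2 : weave3_completion [set (a, 0); (b, 0); (c, 1)] by apply: W.
have N3 : weave3_completion [set (a, 1); (b, 0); (c, 0)] by apply: W.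
(* The side joining the center to the second vertex is vertical. *)
exists (a, 0), (a, 1), (b, 0); split.
  split; first by split=> -[].
    split; [exists (fiber a)|exists [set (a, 0); (b, 0); (c, 1)]
           |exists [set (a, 1); (b, 0); (c, 0)]]; split=> //;
      try exact/fiberE; by left; (left + right).
  move=> [m [[/weave3_not_vertical Wm|[d _ <-]] m0 m1 mb]].
    by have /= := Wm _ _ m0 m1; apply.
  by move: m0 mb => /fiberE /= <- /fiberE /= /esym.
(* The first product is the remaining point of the fiber; the other levels come from the sum. Both
   sides of the miter law give [(b, 1)], since 0 + 0 + 1 and 2 + 1 + 1 are both 1 modulo 3. *)
exists (a, 2%:R), (c, 1), (c, 0), (b, 1); split; [split; right; split=> //|].
  by case.
by split; right; split; [by case|exact: W|by case|exact: W].
Qed.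

End Weave.

Theorem mainTheorem7 (S : Type) (L : set (set S))
    (sts_L : steiner_triple_system L) :
  (anti_pasch L -> anti_pasch (weave3 L)) /\
  exists N : set (set (S * 'Z_3)),
    [/\ unique (linear_completion (weave3 L)) N,
        anti_pasch L -> anti_pasch N
      & L !=set0 -> contains_miter N].
Proof.
have anti_pasch_completion := completion_anti_pasch sts_L.
(* A Veblen configuration in the weaving is also one in the completion. *)
split=> [/anti_pasch_completion apN [P [Q [V QW]]]|].
  by apply: apN; exists P, Q; split=> // l /QW; left.
exists (weave3_completion L); split=> //.
- split; first exact: completion_linear_completion.
  exact: linear_completion_unique.
- exact: completion_contains_miter.
Qed.
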